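(* Let $\mathbf{x}\in\mathbb{R}^{N_{\mathbf{x}}\times 1}$ be an unknown deterministic real valued parameter vector and let $\mathbf{y}\in\mathbb{C}^{N_{\mathbf{y}}\times 1}$ be connected with $\mathbf{x}$ via the linear model $\mathbf{y}=\mathbf{H}\mathbf{x}+\mathbf{n}$, where $\mathbf{H}\in\mathbb{C}^{N_{\mathbf{y}}\times N_{\mathbf{x}}}$ is a known matrix and $\mathbf{n}\in\mathbb{C}^{N_{\mathbf{y}}\times 1}$ is a zero mean complex random noise vector with augmented covariance matrix $\underline{\mathbf{C}}_{\mathbf{n}\mathbf{n}}$. Let $$\widetilde{\mathbf{H}}=\begin{bmatrix}\mathbf{H}\\ \mathbf{H}^*\end{bmatrix}\in\mathbb{C}^{2N_{\mathbf{y}}\times N_{\mathbf{x}}},\qquad \underline{\mathbf{y}}=\begin{bmatrix}\mathbf{y}\\ \mathbf{y}^*\end{bmatrix}\in\mathbb{C}^{2N_{\mathbf{y}}\times 1}.$$ Assume that $\underline{\mathbf{C}}_{\mathbf{n}\mathbf{n}}$ is invertible and that $\begin{bmatrix}\Re\{\mathbf{H}\}\\ \Im\{\mathbf{H}\}\end{bmatrix}\in\mathbb{R}^{2N_{\mathbf{y}}\times N_{\mathbf{x}}}$ has full rank with $2N_{\mathbf{y}}\ge N_{\mathbf{x}}$. Then the best widely linear unbiased estimator (BWLUE) for real valued parameter vectors is given by $$\hat{\mathbf{x}}_{\mathrm{BW}}=\mathbf{G}_{\mathrm{BW}}\,\underline{\mathbf{y}},\qquad \mathbf{G}_{\mathrm{BW}}=\left(\widetilde{\mathbf{H}}^H\underline{\mathbf{C}}_{\mathbf{n}\mathbf{n}}^{-1}\widetilde{\mathbf{H}}\right)^{-1}\widetilde{\mathbf{H}}^H\underline{\mathbf{C}}_{\mathbf{n}\mathbf{n}}^{-1}.$$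 This estimator is unbiased in the classical sense, i.e. $E[\hat{\mathbf{x}}_{\mathrm{BW}}]=\mathbf{x}$ for every $\mathbf{x}\in\mathbb{R}^{N_{\mathbf{x}}\times 1}$, and its covariance matrix is $$\mathbf{C}_{\hat{\mathbf{x}}\hat{\mathbf{x}},\mathrm{BW}}=E\left[\left(\hat{\mathbf{x}}_{\mathrm{BW}}-E[\hat{\mathbf{x}}_{\mathrm{BW}}]\right)\left(\hat{\mathbf{x}}_{\mathrm{BW}}-E[\hat{\mathbf{x}}_{\mathrm{BW}}]\right)^H\right]=\mathbf{G}_{\mathrm{BW}}\,\underline{\mathbf{C}}_{\mathbf{n}\mathbf{n}}\,\mathbf{G}_{\mathrm{BW}}^H=\left(\widetilde{\mathbf{H}}^H\underline{\mathbf{C}}_{\mathbf{n}\mathbf{n}}^{-1}\widetilde{\mathbf{H}}\right)^{-1}.$$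
   Context: Notation: $(\cdot)^T$, $(\cdot)^H$ and $(\cdot)^*$ denote transposition, conjugate transposition and (entrywise) complex conjugation; $\Re\{\cdot\}$ and $\Im\{\cdot\}$ denote (entrywise) real and imaginary parts. Augmented covariance matrix: for a zero mean complex random vector $\mathbf{n}$ with finite second moments, put $\mathbf{C}_{\mathbf{n}\mathbf{n}}=E[\mathbf{n}\mathbf{n}^H]$ (covariance matrix) and $\widetilde{\mathbf{C}}_{\mathbf{n}\mathbf{n}}=E[\mathbf{n}\mathbf{n}^T]$ (complementary covariance matrix, not assumed to vanish). With $\underline{\mathbf{n}}=\begin{bmatrix}\mathbf{n}\\ \mathbf{n}^*\end{bmatrix}$, the augmented covariance matrix is $$\underline{\mathbf{C}}_{\mathbf{n}\mathbf{n}}=E[\underline{\mathbf{n}}\,\underline{\mathbf{n}}^H]=\begin{bmatrix}\mathbf{C}_{\mathbf{n}\mathbf{n}}&\widetilde{\mathbf{C}}_{\mathbf{n}\mathbf{n}}\\ \widetilde{\mathbf{C}}_{\mathbf{n}\mathbf{n}}^*&\mathbf{C}_{\mathbf{n}\mathbf{n}}^*\end{bmatrix}.$$ BWLUE for real valued parameter vectors: a widely linear estimator has the form $\hat{\mathbf{x}}=\mathbf{E}\mathbf{y}+\mathbf{F}\mathbf{y}^*$ with $\mathbf{E},\mathbf{F}\in\mathbb{C}^{N_{\mathbf{x}}\times N_{\mathbf{y}}}$; its $i$-th component is $\hat{x}_i=\mathbf{e}_i^H\mathbf{y}+\mathbf{f}_i^H\mathbf{y}^*$, where $\mathbf{e}_i^H$,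 $\mathbf{f}_i^H$ are the $i$-th rows of $\mathbf{E}$, $\mathbf{F}$. The BWLUE for real valued parameter vectors is the widely linear estimator for which, for each $i=1,\dots,N_{\mathbf{x}}$, the component $\hat{x}_i$ minimizes the variance $E[|\hat{x}_i-E[\hat{x}_i]|^2]$ among all choices of $(\mathbf{e}_i,\mathbf{f}_i)$ satisfying (1) $\Im\{\hat{x}_i\}=0$ for every realization $\mathbf{y}\in\mathbb{C}^{N_{\mathbf{y}}\times 1}$ (equivalently $\mathbf{e}_i^H=\mathbf{f}_i^T$), and (2) $E[\hat{x}_i]=x_i$ for every $\mathbf{x}\in\mathbb{R}^{N_{\mathbf{x}}\times 1}$. *)

(* Defs.v *)
From HB Require Import structures.
From mathcomp Require Import all_boot all_order all_algebra.
From mathcomp Require Import all_classical all_reals all_analysis.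
From mathcomp Require Import complex.

Set Implicit Arguments.
Unset Strict Implicit.
Unset Printing Implicit Defensive.

Import Order.TTheory GRing.Theory Num.Theory.
Import numFieldNormedType.Exports.

Local Open Scope ring_scope.
Local Open Scope complex_scope.

Definition mxconjc {R : realType} {m n : nat} (A : 'M[R[i]]_(m, n)) :
  'M[R[i]]_(m, n) := map_mx conjc A.

Definition mxadjc {R : realType} {m n : nat} (A : 'M[R[i]]_(m, n)) :
  'M[R[i]]_(n, m) := (mxconjc A)^T.

Definition mxRe {R : realType} {m n : nat} (A : 'M[R[i]]_(m, n)) :
  'M[R]_(m, n) := map_mx (@complex.Re R) A.

Definition mxIm {R : realType} {m n : nat} (A : 'M[R[i]]_(m, n)) :
  'M[R]_(m, n) := map_mx (@complex.Im R) A.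

Definition mxreal {R : realType} {m n : nat} (A : 'M[R]_(m, n)) :
  'M[R[i]]_(m, n) := map_mx (real_complex R) A.

(* Serves both for the augmented vectors [y; y^*] and for [H; H^*]. *)
Definition augment {R : realType} {m n : nat} (A : 'M[R[i]]_(m, n)) :
  'M[R[i]]_(m + m, n) := col_mx A (mxconjc A).

Section Expectation.
Context {d : measure_display} {T : measurableType d} {R : realType}.
Variable P : probability T R.

(* [fine] maps infinite values to 0; it is only meaningful for integrable
   [Z]. *)
Definition cexpect (Z : T -> R[i]) : R[i] :=
  fine ('E_P[fun w => complex.Re (Z w)])%E +i*
  fine ('E_P[fun w => complex.Im (Z w)])%E.

Definition mxexpect {m n : nat} (Z : T -> 'M[R[i]]_(m, n)) : 'M[R[i]]_(m, n) :=
  \matrix_(i, j) cexpect (fun w => Z w i j).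

(* Extended-real valued, so that a non-square-integrable [Z] does not get a
   spuriously small variance. *)
Definition cvariance (Z : T -> R[i]) : \bar R :=
  ('E_P[fun w => (ComplexField.Normc.normc (Z w - cexpect Z) ^+ 2)%R])%E.

Definition mxcovariance {m : nat} (Z : T -> 'cV[R[i]]_m) : 'M[R[i]]_m :=
  mxexpect (fun w => (Z w - mxexpect Z) *m mxadjc (Z w - mxexpect Z)).

(* Membership in [Lfun] includes measurability. *)
Definition square_integrable {m : nat} (Z : T -> 'cV[R[i]]_m) : Prop :=
  forall j : 'I_m, (fun w => complex.Re (Z w j ord0)) \in Lfun P 2%:E /\
                   (fun w => complex.Im (Z w j ord0)) \in Lfun P 2%:E.

Definition augcov {m : nat} (n : T -> 'cV[R[i]]_m) : 'M[R[i]]_(m + m) :=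
  mxexpect (fun w => augment (n w) *m mxadjc (augment (n w))).

End Expectation.

Section BWLUE.
Context {d : measure_display} {T : measurableType d} {R : realType}.
Variable P : probability T R.
Context {Ny Nx : nat}.
Variables (H : 'M[R[i]]_(Ny, Nx)) (n : T -> 'cV[R[i]]_Ny).

Definition observation (x : 'cV[R]_Nx) (w : T) : 'cV[R[i]]_Ny :=
  H *m mxreal x + n w.

Definition wl_component (e f : 'cV[R[i]]_Ny) (y : 'cV[R[i]]_Ny) : R[i] :=
  (mxadjc e *m y + mxadjc f *m mxconjc y) ord0 ord0.

Definition wl_real_valued (e f : 'cV[R[i]]_Ny) : Prop :=
  forall y : 'cV[R[i]]_Ny, complex.Im (wl_component e f y) = 0.

Definition wl_unbiased (i : 'I_Nx) (e f : 'cV[R[i]]_Ny) : Prop :=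
  forall x : 'cV[R]_Nx,
    cexpect P (fun w => wl_component e f (observation x w)) = (x i ord0)%:C.

Definition wl_admissible (i : 'I_Nx) (e f : 'cV[R[i]]_Ny) : Prop :=
  wl_real_valued e f /\ wl_unbiased i e f.

Definition wl_variance (e f : 'cV[R[i]]_Ny) (x : 'cV[R]_Nx) : \bar R :=
  cvariance P (fun w => wl_component e f (observation x w)).

(* The parameter [x] is deterministic and unknown, so optimality is required
   at every [x]. *)
Definition wl_optimal (i : 'I_Nx) (e f : 'cV[R[i]]_Ny) : Prop :=
  wl_admissible i e f /\
  forall e' f' : 'cV[R[i]]_Ny, wl_admissible i e' f' ->
    forall x : 'cV[R]_Nx, (wl_variance e f x <= wl_variance e' f' x)%E.

(* [e_i] and [f_i] are the columns whose conjugate transposes are the [i]-th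
   rows of [E] and [F]. *)
Definition is_BWLUE (xhat : 'cV[R[i]]_Ny -> 'cV[R[i]]_Nx) : Prop :=
  exists E F : 'M[R[i]]_(Nx, Ny),
    (forall y, xhat y = E *m y + F *m mxconjc y) /\
    (forall i : 'I_Nx, wl_optimal i (mxadjc (row i E)) (mxadjc (row i F))).

End BWLUE.

Section Formula.
Context {R : realType} {Ny Nx : nat}.
Variables (H : 'M[R[i]]_(Ny, Nx)) (C : 'M[R[i]]_(Ny + Ny)).

Definition BW_gram : 'M[R[i]]_Nx :=
  mxadjc (augment H) *m invmx C *m augment H.

Definition BW_gain : 'M[R[i]]_(Nx, Ny + Ny) :=
  invmx BW_gram *m mxadjc (augment H) *m invmx C.

End Formula.

(* Main.v *)
Require Import Defs.
From HB Require Import structures.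
From mathcomp Require Import all_boot all_order all_algebra.
From mathcomp Require Import all_classical all_reals all_analysis.
From mathcomp Require Import complex ring.

Set Implicit Arguments.
Unset Strict Implicit.
Unset Printing Implicit Defensive.

Import Order.TTheory GRing.Theory Num.Theory.
Import numFieldNormedType.Exports.

Local Open Scope ring_scope.
Local Open Scope complex_scope.

(** For a linear model with a real parameter, a widely linear estimate of one
    component is a row [g] applied to the augmented observation [y; y^*].
    Such a row has real values on every [y] exactly when conjugating it swaps
    its two halves ([wl_real_valuedP]), and it is unbiased for component [i]
    exactly when [g *m augment H] is the [i]-th unit row ([wl_unbiasedP]).
    Its variance is the Hermitian form [g C g^H] of the augmented covariance
    matrix [C] ([wl_varianceE]), whatever the parameter.

    Dropping the realness constraint leaves generalized least squares with
    design matrix [augment H].  Full rank of the stacked real and imaginary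
    parts of [H] gives [augment H] a left inverse ([augment_left_inverse]);
    [C] is positive semidefinite as a second moment, hence definite since it
    is invertible ([psdmx_definite]).  So the Gram matrix is invertible, and by
    orthogonality of the error every unbiased row [g] satisfies
    [g C g^H = g0 C g0^H + (g - g0) C (g - g0)^H], where [g0] is the matching
    row of the gain ([gauss_markov]).  The excess is nonnegative, and vanishes
    only for [g = g0].

    The relaxation costs nothing: [C] and [augment H] are both compatible with
    conjugation through the matrix swapping the two halves, so the rows of the
    gain satisfy the realness constraint ([mxconjc_BW_gain]).  Hence the
    optimal rows are exactly those of the gain ([wl_optimalP]); optimality and
    uniqueness come from the same identity.  The mean and the covariance of
    the estimator follow from linearity of the expectation. *)

(** * Expectation of complex random variables and matrices *)

Section ComplexExpectation.
Context {d : measure_display} {T : measurableType d} {R : realType}.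
Variable P : probability T R.

Definition Lfunc (p : \bar R) (Z : T -> R[i]) : Prop :=
  (fun w => complex.Re (Z w)) \in Lfun P p /\
  (fun w => complex.Im (Z w)) \in Lfun P p.

Lemma Lfunc_cst c : Lfunc 1 (fun=> c).
Proof. by split; exact: Lfun_cst. Qed.

Lemma LfuncD Z Z' : Lfunc 1 Z -> Lfunc 1 Z' -> Lfunc 1 (fun w => Z w + Z' w).
Proof.
move=> [Zr Zi] [Zr' Zi'].
by split; under eq_fun do rewrite raddfD; [exact: (rpredD Zr)|exact: (rpredD Zi)].
Qed.

Lemma ReM (a b : R[i]) : complex.Re (a * b) =
  complex.Re a * complex.Re b - complex.Im a * complex.Im b.
Proof. by case: a b => [? ?] []. Qed.

Lemma ImM (a b : R[i]) : complex.Im (a * b) =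
  complex.Re a * complex.Im b + complex.Im a * complex.Re b.
Proof. by case: a b => [? ?] [? ?] /=. Qed.

Lemma ReJ (a : R[i]) : complex.Re a^* = complex.Re a.
Proof. by case: a. Qed.

Lemma ImJ (a : R[i]) : complex.Im a^* = - complex.Im a.
Proof. by case: a. Qed.

Lemma Lfunc_conj p Z : (1 <= p)%E -> Lfunc p Z -> Lfunc p (fun w => (Z w)^*).
Proof.
move=> p1 [Zr Zi]; split; first by under eq_fun do rewrite ReJ.
by under eq_fun do rewrite ImJ; exact: (@rpredNr _ (Lfun P p)).
Qed.

(** Cauchy-Schwarz, applied to the four products of real and imaginary parts. *)
Lemma Lfunc2M Z Z' :
  Lfunc 2%:E Z -> Lfunc 2%:E Z' -> Lfunc 1 (fun w => Z w * Z' w).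
Proof.
move=> [Zr Zi] [Zr' Zi']; split.
  under eq_fun do rewrite ReM.
  exact: (rpredB (Lfun2_mul_Lfun1 Zr Zr') (Lfun2_mul_Lfun1 Zi Zi')).
under eq_fun do rewrite ImM.
exact: (rpredD (Lfun2_mul_Lfun1 Zr Zi') (Lfun2_mul_Lfun1 Zi Zr')).
Qed.

(** A probability measure is finite. *)
Lemma Lfunc21 Z : Lfunc 2%:E Z -> Lfunc 1 Z.
Proof.
have P_fin : P [set: T]%classic \is a fin_num by exact: fin_num_measure.
by move=> [Zr Zi]; split; exact: Lfun_subset12.
Qed.

Lemma LfuncMl c Z : Lfunc 1 Z -> Lfunc 1 (fun w => c * Z w).
Proof.
move=> [Zr Zi].
have scale a X : X \in Lfun P 1 -> (fun w => a * X w) \in Lfun P 1.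
  by move=> /(Lfun_scale a (lexx 1)); under eq_fun do rewrite mulrC.
split.
  under eq_fun do rewrite ReM.
  exact: (rpredB (scale _ _ Zr) (scale _ _ Zi)).
under eq_fun do rewrite ImM.
exact: (rpredD (scale _ _ Zi) (scale _ _ Zr)).
Qed.

Lemma cexpect_cst c : cexpect P (fun=> c) = c.
Proof. by rewrite /cexpect !expectation_cst /=; case: c. Qed.

(* The real expectation as a real number, so that its linearity can be used
   separately in the two coordinates of [cexpect]. *)
Let E (X : T -> R) : R := fine ('E_P[X])%E.

Let ED X Y : X \in Lfun P 1 -> Y \in Lfun P 1 ->
  E (fun w => X w + Y w) = E X + E Y.
Proof.
move=> X1 Y1; rewrite /E.
by rewrite [X in fine X](expectationD X1 Y1) fineD ?expectation_fin_num.
Qed.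

Let EMl a X : X \in Lfun P 1 -> E (fun w => a * X w) = a * E X.
Proof.
move=> X1; rewrite /E; under eq_fun do rewrite mulrC.
by rewrite [X in fine X](expectationZl a X1) fineM ?expectation_fin_num.
Qed.

Lemma cexpectD Z Z' : Lfunc 1 Z -> Lfunc 1 Z' ->
  cexpect P (fun w => Z w + Z' w) = cexpect P Z + cexpect P Z'.
Proof.
move=> [Zr Zi] [Zr' Zi']; rewrite /cexpect.
under eq_fun do rewrite raddfD.
under [X in _ +i* fine 'E_P[X]]eq_fun do rewrite raddfD.
by congr (_ +i* _); exact: ED.
Qed.

Lemma cexpectMl c Z : Lfunc 1 Z ->
  cexpect P (fun w => c * Z w) = c * cexpect P Z.
Proof.
move=> [Zr Zi].
have scale a X : X \in Lfun P 1 -> (fun w => a * X w) \in Lfun P 1.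
  by move=> /(Lfun_scale a (lexx 1)); under eq_fun do rewrite mulrC.
rewrite /cexpect.
under eq_fun do rewrite ReM -mulNr.
under [X in _ +i* fine 'E_P[X]]eq_fun do rewrite ImM.
rewrite -/(E _) -/(E (fun _ => _ + _)) !ED ?scale// !EMl//.
by apply/eqP; rewrite eq_complex ReM ImM /= mulNr !eqxx.
Qed.

Lemma cexpect_conj Z : Lfunc 1 Z ->
  cexpect P (fun w => (Z w)^*) = (cexpect P Z)^*.
Proof.
move=> [Zr Zi]; rewrite /cexpect.
under eq_fun do rewrite ReJ.
under [X in _ +i* fine 'E_P[X]]eq_fun do rewrite ImJ -mulN1r.
by congr (_ +i* _); rewrite -/(E _) EMl// mulN1r.
Qed.

Lemma Lfunc_sum (I : Type) (r : seq I) (Z : I -> T -> R[i]) :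
  (forall k, Lfunc 1 (Z k)) -> Lfunc 1 (fun w => \sum_(k <- r) Z k w).
Proof.
move=> Z1; elim: r => [|k r IHr].
  by under eq_fun do rewrite big_nil; exact: Lfunc_cst.
by under eq_fun do rewrite big_cons; exact: LfuncD.
Qed.

Lemma cexpect_sum (I : Type) (r : seq I) (Z : I -> T -> R[i]) :
  (forall k, Lfunc 1 (Z k)) ->
  cexpect P (fun w => \sum_(k <- r) Z k w) = \sum_(k <- r) cexpect P (Z k).
Proof.
move=> Z1; elim: r => [|k r IHr].
  by under eq_fun do rewrite big_nil; rewrite big_nil cexpect_cst.
under eq_fun do rewrite big_cons.
by rewrite cexpectD ?IHr ?big_cons//; exact: Lfunc_sum.
Qed.

Definition mxLfunc {m n : nat} (p : \bar R) (Z : T -> 'M[R[i]]_(m, n)) : Prop :=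
  forall i j, Lfunc p (fun w => Z w i j).

Lemma mxLfunc_mulmxl {m n q : nat} (A : 'M[R[i]]_(m, n)) (Z : T -> 'M[R[i]]_(n, q)) :
  mxLfunc 1 Z -> mxLfunc 1 (fun w => A *m Z w).
Proof.
move=> Z1 i j; under eq_fun do rewrite mxE.
by apply: Lfunc_sum => k; exact: LfuncMl.
Qed.

Lemma mxLfunc_mulmxr {m n q : nat} (A : 'M[R[i]]_(n, q))
    (Z : T -> 'M[R[i]]_(m, n)) :
  mxLfunc 1 Z -> mxLfunc 1 (fun w => Z w *m A).
Proof.
move=> Z1 i j; under eq_fun do rewrite mxE.
by apply: Lfunc_sum => k; under eq_fun do rewrite mulrC; exact: LfuncMl.
Qed.

Lemma mxLfunc2M {m n q : nat} (Y : T -> 'M[R[i]]_(m, n)) (Z : T -> 'M[R[i]]_(n, q)) :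
  mxLfunc 2%:E Y -> mxLfunc 2%:E Z -> mxLfunc 1 (fun w => Y w *m Z w).
Proof.
move=> Y2 Z2 i j; under eq_fun do rewrite mxE.
by apply: Lfunc_sum => k; exact: Lfunc2M.
Qed.

Lemma mxLfunc_adj {m n : nat} p (Z : T -> 'M[R[i]]_(m, n)) : (1 <= p)%E ->
  mxLfunc p Z -> mxLfunc p (fun w => mxadjc (Z w)).
Proof. by move=> p1 Zp i j; under eq_fun do rewrite !mxE; exact: Lfunc_conj. Qed.

Lemma mxexpect_cst {m n : nat} (A : 'M[R[i]]_(m, n)) : mxexpect P (fun=> A) = A.
Proof. by apply/matrixP => i j; rewrite mxE cexpect_cst. Qed.

Lemma mxexpectD {m n : nat} (Y Z : T -> 'M[R[i]]_(m, n)) : mxLfunc 1 Y -> mxLfunc 1 Z ->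
  mxexpect P (fun w => Y w + Z w) = mxexpect P Y + mxexpect P Z.
Proof.
move=> Y1 Z1; apply/matrixP => i j; rewrite !mxE -cexpectD//.
by under eq_fun do rewrite mxE.
Qed.

Lemma mxexpect_mulmxl {m n q : nat} (A : 'M[R[i]]_(m, n)) (Z : T -> 'M[R[i]]_(n, q)) :
  mxLfunc 1 Z -> mxexpect P (fun w => A *m Z w) = A *m mxexpect P Z.
Proof.
move=> Z1; apply/matrixP => i j; rewrite !mxE.
under eq_fun do rewrite mxE.
rewrite cexpect_sum => [|k]; last exact: LfuncMl.
by apply: eq_bigr => k _; rewrite cexpectMl// mxE.
Qed.

Lemma mxexpect_conj {m n : nat} (Z : T -> 'M[R[i]]_(m, n)) : mxLfunc 1 Z ->
  mxexpect P (fun w => mxconjc (Z w)) = mxconjc (mxexpect P Z).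
Proof.
move=> Z1; apply/matrixP => i j; rewrite !mxE -cexpect_conj//.
by under eq_fun do rewrite mxE.
Qed.

Lemma mxexpect_tr {m n : nat} (Z : T -> 'M[R[i]]_(m, n)) :
  mxexpect P (fun w => (Z w)^T) = (mxexpect P Z)^T.
Proof.
by apply/matrixP => i j; rewrite !mxE; under eq_fun do rewrite mxE.
Qed.

Lemma mxexpect_mulmxr {m n q : nat} (A : 'M[R[i]]_(n, q)) (Z : T -> 'M[R[i]]_(m, n)) :
  mxLfunc 1 Z -> mxexpect P (fun w => Z w *m A) = mxexpect P Z *m A.
Proof.
move=> Z1; under eq_fun do rewrite -[_ *m A]trmxK trmx_mul.
rewrite mxexpect_tr mxexpect_mulmxl ?mxexpect_tr -?trmx_mul ?trmxK// => i j.
by under eq_fun do rewrite mxE.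
Qed.

Lemma mxexpect_adj {m n : nat} (Z : T -> 'M[R[i]]_(m, n)) : mxLfunc 1 Z ->
  mxexpect P (fun w => mxadjc (Z w)) = mxadjc (mxexpect P Z).
Proof. by move=> Z1; rewrite mxexpect_tr mxexpect_conj. Qed.

End ComplexExpectation.

(** * Hermitian forms *)

Section HermitianForms.
Context {R : realType}.

Lemma mxconjc_mul {m n p : nat} (A : 'M[R[i]]_(m, n)) (B : 'M[R[i]]_(n, p)) :
  mxconjc (A *m B) = mxconjc A *m mxconjc B.
Proof. exact: map_mxM. Qed.

Lemma mxconjc_inv {k : nat} (A : 'M[R[i]]_k) : mxconjc (invmx A) = invmx (mxconjc A).
Proof. exact: map_invmx. Qed.

Lemma mxadjc_conj {m n : nat} (A : 'M[R[i]]_(m, n)) :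
  mxadjc (mxconjc A) = mxconjc (mxadjc A).
Proof. by apply/matrixP => i j; rewrite !mxE. Qed.

Lemma mxadjcM {m n p : nat} (A : 'M[R[i]]_(m, n)) (B : 'M[R[i]]_(n, p)) :
  mxadjc (A *m B) = mxadjc B *m mxadjc A.
Proof. by rewrite /mxadjc /mxconjc map_mxM trmx_mul. Qed.

Lemma mxconjcK {m n : nat} : involutive (@mxconjc R m n).
Proof. by move=> A; apply/matrixP => i j; rewrite !mxE conjcK. Qed.

Lemma mxadjcK {m n : nat} (A : 'M[R[i]]_(m, n)) : mxadjc (mxadjc A) = A.
Proof. by apply/matrixP => i j; rewrite !mxE conjcK. Qed.

Lemma mxadjcD {m n : nat} (A B : 'M[R[i]]_(m, n)) :
  mxadjc (A + B) = mxadjc A + mxadjc B.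
Proof. by rewrite /mxadjc /mxconjc map_mxD linearD. Qed.

Lemma mxadjcB {m n : nat} (A B : 'M[R[i]]_(m, n)) :
  mxadjc (A - B) = mxadjc A - mxadjc B.
Proof. by rewrite /mxadjc /mxconjc map_mxB linearB. Qed.

Lemma mxadjcZ {m n : nat} (c : R[i]) (A : 'M[R[i]]_(m, n)) :
  mxadjc (c *: A) = conjc c *: mxadjc A.
Proof. by rewrite /mxadjc /mxconjc map_mxZ linearZ. Qed.

Lemma mxadjc0 {m n : nat} : mxadjc (0 : 'M[R[i]]_(m, n)) = 0.
Proof. by apply/matrixP => i j; rewrite !mxE rmorph0. Qed.

Lemma mxadjc_inv {m : nat} (A : 'M[R[i]]_m) : mxadjc (invmx A) = invmx (mxadjc A).
Proof. by rewrite /mxadjc /mxconjc map_invmx trmx_inv. Qed.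

Lemma mulmx1_invmx {k : nat} (A B : 'M[R[i]]_k) : A *m B = 1%:M -> invmx B = A.
Proof.
by move=> AB; have [_ Bu] := mulmx1_unit AB;
  rewrite -[A](mulmxK Bu) AB mul1mx.
Qed.

Definition psdmx {m : nat} (C : 'M[R[i]]_m) : Prop :=
  mxadjc C = C /\ forall u : 'rV_m, 0 <= (u *m C *m mxadjc u) 0 0.

Lemma mul_adjcE {m : nat} (u : 'rV[R[i]]_m) :
  (u *m mxadjc u) 0 0 = \sum_j `|u 0 j| ^+ 2.
Proof. by rewrite mxE; apply: eq_bigr => j _; rewrite !mxE sqr_normc. Qed.

Lemma mul_adjc_ge0 {m : nat} (u : 'rV[R[i]]_m) : 0 <= (u *m mxadjc u) 0 0.
Proof. by rewrite mul_adjcE sumr_ge0// => j _; rewrite exprn_ge0. Qed.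

Lemma mul_adjc_eq0 {m : nat} (u : 'rV[R[i]]_m) :
  (u *m mxadjc u) 0 0 = 0 -> u = 0.
Proof.
rewrite mul_adjcE => /eqP; rewrite psumr_eq0 => [|j _]; last by rewrite exprn_ge0.
move=> /allP u0; apply/rowP => j; rewrite mxE; apply/eqP.
by have := u0 j (mem_index_enum j); rewrite expf_eq0 normr_eq0.
Qed.

(** The form at [(q + 1) u - s u C], where [s] is the squared norm of [u C] and
    [q] the value of the form at [u C], is [- s^2 (q + 2)]; being nonnegative,
    it forces [u C = 0]. *)
Lemma psdmx_definite {m : nat} (C : 'M[R[i]]_m) (u : 'rV_m) :
  psdmx C -> C \in unitmx -> (u *m C *m mxadjc u) 0 0 = 0 -> u = 0.
Proof.
move=> [C_herm C_ge0] C_unit uCu.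
pose v := u *m C; pose s : R[i] := (v *m mxadjc v) 0 0.
pose q : R[i] := (v *m C *m mxadjc v) 0 0.
have s_ge0 : 0 <= s by exact: mul_adjc_ge0.
have q_ge0 : 0 <= q by exact: C_ge0.
have uCv : (u *m C *m mxadjc v) 0 0 = s by [].
have vCu : (v *m C *m mxadjc u) 0 0 = s.
  by rewrite -[C in LHS]C_herm -mulmxA -mxadjcM.
pose w := (q + 1) *: u - s *: v.
have cJ (c : R[i]) : 0 <= c -> conjc c = c.
  by case: c => a b; rewrite lecE /= => /andP[/eqP -> _]; rewrite oppr0.
have : 0 <= - (s ^+ 2 * (q + 2)).
  have := C_ge0 w; congr (_ <= _).
  rewrite /w mxadjcB !mxadjcZ !mulmxBl !mulmxBr -!scalemxAl -!scalemxAr.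
  have vCv : (v *m C *m mxadjc v) 0 0 = q by [].
  move: (u *m C *m mxadjc u) (u *m C *m mxadjc v) (v *m C *m mxadjc u)
    (v *m C *m mxadjc v) uCu uCv vCu vCv => U1 U2 U3 U4 uCu uCv vCu vCv.
  rewrite !mxE uCu uCv vCu vCv (cJ _ s_ge0) (cJ (q + 1)) ?addr_ge0//.
  ring.
rewrite oppr_ge0 => sq_le0.
have : s ^+ 2 * (q + 2) = 0.
  by apply/le_anti; rewrite sq_le0 mulr_ge0 ?exprn_ge0 ?addr_ge0.
move=> /eqP; rewrite mulf_eq0 expf_eq0 /= => /orP[/eqP s0|]; last first.
  by rewrite gt_eqF// ltr_wpDl.
by rewrite -[u](mulmxK C_unit) -/v (mul_adjc_eq0 s0) mul0mx.
Qed.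

End HermitianForms.

(** * Generalized least squares *)

Section GaussMarkov.
Context {R : realType} {m k : nat}.
Variables (A : 'M[R[i]]_(m, k)) (L : 'M[R[i]]_(k, m)) (C : 'M[R[i]]_m).
Hypotheses (LA : L *m A = 1%:M) (C_psd : psdmx C) (C_unit : C \in unitmx).

Let gram := mxadjc A *m invmx C *m A.
Let gain := invmx gram *m mxadjc A *m invmx C.

(** If [v] annihilates the Gram matrix, the form of [C] vanishes at
    [v A^H C^-1], so [v A^H = 0], and the left inverse of [A] gives [v = 0]. *)
Lemma gram_unit : gram \in unitmx.
Proof.
have [C_herm C_ge0] := C_psd.
rewrite -row_free_unit; apply: inj_row_free => v vG0.
pose u := v *m mxadjc A *m invmx C.
have uC : u *m C = v *m mxadjc A by rewrite mulmxKV.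
have u0 : u = 0.
  apply: (psdmx_definite C_psd C_unit).
  rewrite uC !mxadjcM mxadjc_inv C_herm mxadjcK !mulmxA.
  have -> : v *m mxadjc A *m invmx C *m A = 0 by rewrite -vG0 /gram !mulmxA.
  by rewrite mul0mx mxE.
have vA0 : v *m mxadjc A = 0 by rewrite -uC u0 mul0mx.
rewrite -[v]mulmx1 -[1%:M]mxadjcK.
have -> : mxadjc (1%:M : 'M[R[i]]_k) = L *m A.
  by rewrite LA /mxadjc /mxconjc map_mx1 trmx1.
by rewrite mxadjcM mulmxA vA0 mul0mx.
Qed.

Lemma gain_unbiased : gain *m A = 1%:M.
Proof.
have -> : gain *m A = invmx gram *m gram by rewrite /gain /gram -!mulmxA.
exact: mulVmx gram_unit.
Qed.

Lemma gram_herm : mxadjc gram = gram.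
Proof. by rewrite /gram !mxadjcM mxadjc_inv mxadjcK C_psd.1 mulmxA. Qed.

Lemma gain_cov : gain *m C = invmx gram *m mxadjc A.
Proof. exact: mulmxKV. Qed.

Lemma cov_adj_gain : C *m mxadjc gain = A *m invmx gram.
Proof.
have := congr1 mxadjc gain_cov.
by rewrite [LHS]mxadjcM [RHS]mxadjcM C_psd.1 mxadjcK mxadjc_inv gram_herm.
Qed.

Lemma gain_variance : gain *m C *m mxadjc gain = invmx gram.
Proof. by rewrite -mulmxA cov_adj_gain mulmxA gain_unbiased mul1mx. Qed.

(** The cross terms vanish: [C g0^H] lies in the column space of [A], which
    [g - g0] annihilates because both rows have the same product with [A]. *)
Lemma gauss_markov (g g0 : 'rV[R[i]]_m) (b : 'rV[R[i]]_k) :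
    g *m A = b -> g0 = b *m gain ->
  g *m C *m mxadjc g =
    g0 *m C *m mxadjc g0 + (g - g0) *m C *m mxadjc (g - g0).
Proof.
move=> gA ->; set g1 := b *m gain.
have g1A : g1 *m A = b by rewrite -mulmxA gain_unbiased mulmx1.
have Cg1 : C *m mxadjc g1 = A *m (invmx gram *m mxadjc b).
  by rewrite mxadjcM mulmxA cov_adj_gain -mulmxA.
have orth : (g - g1) *m C *m mxadjc g1 = 0.
  by rewrite -mulmxA Cg1 mulmxA mulmxBl gA g1A subrr mul0mx.
have orth' : g1 *m C *m mxadjc (g - g1) = 0.
  by have := congr1 mxadjc orth; rewrite mxadjc0 2!mxadjcM mxadjcK C_psd.1 mulmxA.
have gE : g = g1 + (g - g1) by rewrite addrC subrK.
move: (g - g1) orth orth' gE => h orth orth' ->.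
by rewrite mxadjcD !mulmxDl !mulmxDr orth orth' addr0 add0r.
Qed.

End GaussMarkov.

(** * Second moments *)

Section SecondMoment.
Context {d : measure_display} {T : measurableType d} {R : realType}.
Variables (P : probability T R) (m : nat) (Z : T -> 'cV[R[i]]_m).
Hypothesis Z2 : mxLfunc P 2%:E Z.

Let S := mxexpect P (fun w => Z w *m mxadjc (Z w)).

Lemma mxLfunc1 : mxLfunc P 1 Z.
Proof. by move=> i j; exact/Lfunc21/Z2. Qed.

Lemma mxLfunc_outer : mxLfunc P 1 (fun w => Z w *m mxadjc (Z w)).
Proof. by apply: mxLfunc2M => //; apply: mxLfunc_adj; rewrite ?lee1n. Qed.

Lemma linear_outer {k : nat} (A : 'M[R[i]]_(k, m)) (z : 'cV_m) :
  (A *m z) *m mxadjc (A *m z) = A *m (z *m mxadjc z) *m mxadjc A.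
Proof. by rewrite mxadjcM !mulmxA. Qed.

Lemma second_moment_linear {k : nat} (A : 'M[R[i]]_(k, m)) :
  mxexpect P (fun w => (A *m Z w) *m mxadjc (A *m Z w)) = A *m S *m mxadjc A.
Proof.
under eq_fun do rewrite linear_outer.
rewrite mxexpect_mulmxr ?mxexpect_mulmxl//; first exact: mxLfunc_outer.
exact/mxLfunc_mulmxl/mxLfunc_outer.
Qed.

Lemma normc_sqrE (z : R[i]) : ComplexField.Normc.normc z ^+ 2 = complex.Re (z * conjc z).
Proof.
case: z => a b /=; rewrite sqr_sqrtr ?addr_ge0 ?sqr_ge0// mulrN opprK.
by rewrite !expr2.
Qed.

Lemma mul_conjc_Im (z : R[i]) : complex.Im (z * conjc z) = 0.
Proof. by case: z => a b /=; rewrite mulrN mulrC addNr. Qed.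

Lemma outer_entry (u : 'rV[R[i]]_m) w :
  ((u *m Z w) *m mxadjc (u *m Z w)) 0 0 =
  (u *m Z w) 0 0 * conjc ((u *m Z w) 0 0).
Proof. by rewrite mxE big_ord1; congr (_ * _); rewrite !mxE. Qed.

(** Turns the Hermitian form of the second-moment matrix into the mean of a
    squared modulus, from which positivity and the variance formula follow. *)
Lemma second_moment_row (u : 'rV[R[i]]_m) :
  (u *m S *m mxadjc u) 0 0 =
  cexpect P (fun w => (u *m Z w) 0 0 * conjc ((u *m Z w) 0 0)).
Proof.
rewrite -second_moment_linear mxE; congr (cexpect P _).
by apply/funext => w; exact: outer_entry.
Qed.

Lemma second_moment_psd : psdmx S.
Proof.
split.
  rewrite /S -mxexpect_adj; last exact: mxLfunc_outer.
  by under eq_fun do rewrite mxadjcM mxadjcK.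
move=> u; rewrite second_moment_row /cexpect lecE /=.
under eq_fun do rewrite mul_conjc_Im.
rewrite (expectation_cst P 0) eqxx /= fine_ge0// expectation_ge0// => w.
by rewrite -normc_sqrE sqr_ge0.
Qed.

Hypothesis Z_mean0 : mxexpect P Z = 0.

Lemma mean_affine {k : nat} (A : 'M[R[i]]_(k, m)) (b : 'cV_k) :
  mxexpect P (fun w => b + A *m Z w) = b.
Proof.
rewrite mxexpectD; last exact/mxLfunc_mulmxl/mxLfunc1.
  by rewrite mxexpect_cst mxexpect_mulmxl ?Z_mean0 ?mulmx0 ?addr0//; exact: mxLfunc1.
by move=> i j; exact: Lfunc_cst.
Qed.

Lemma mxcovariance_affine {k : nat} (A : 'M[R[i]]_(k, m)) (b : 'cV_k) :
  mxcovariance P (fun w => b + A *m Z w) = A *m S *m mxadjc A.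
Proof.
rewrite /mxcovariance mean_affine -second_moment_linear.
by under eq_fun do rewrite addrAC subrr add0r.
Qed.

Lemma cexpect_affine (u : 'rV[R[i]]_m) (c : 'cV_1) :
  cexpect P (fun w => (c + u *m Z w) 0 0) = c 0 0.
Proof.
by have := congr1 (fun M : 'M[R[i]]_1 => M 0 0) (mean_affine u c); rewrite mxE.
Qed.

(** The variance is defined in the extended reals, so the square integrability
    of [Z] is what makes it the finite number on the right. *)
Lemma cvariance_affine (u : 'rV[R[i]]_m) (c : 'cV_1) :
  cvariance P (fun w => (c + u *m Z w) 0 0) =
  (complex.Re ((u *m S *m mxadjc u) 0 0))%:E.
Proof.
rewrite /cvariance cexpect_affine second_moment_row /cexpect /= fineK.
  congr ('E_P[_])%E; apply/funext => w.
  by rewrite normc_sqrE mxE addrAC subrr add0r.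
apply: expectation_fin_num.
have : mxLfunc P 1 (fun w => u *m Z w *m mxadjc (u *m Z w)).
  under eq_fun do rewrite linear_outer.
  exact/mxLfunc_mulmxr/mxLfunc_mulmxl/mxLfunc_outer.
by move=> /(_ 0 0)[+ _]; under eq_fun do rewrite outer_entry.
Qed.

End SecondMoment.

(** * Augmented vectors *)

Section Augmentation.
Context {R : realType}.

(** Conjugating an augmented vector amounts to swapping its two halves;
    multiplication by this matrix makes the symmetry algebraic. *)
Definition swapmx {n : nat} : 'M[R[i]]_(n + n) := block_mx 0 1%:M 1%:M 0.

Lemma swapmxK {n : nat} : swapmx *m swapmx = 1%:M :> 'M[R[i]]_(n + n).
Proof.
by rewrite mulmx_block !(mul0mx, mulmx0, mul1mx, addr0, add0r) -scalar_mx_block.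
Qed.

Lemma swapmx_herm {n : nat} : mxadjc (@swapmx n) = swapmx.
Proof.
by rewrite /mxadjc /mxconjc map_block_mx tr_block_mx !map_mx0 !map_mx1 !trmx0 !trmx1.
Qed.

Lemma mxconjc_augment {m n : nat} (A : 'M[R[i]]_(m, n)) :
  mxconjc (augment A) = swapmx *m augment A.
Proof.
rewrite /mxconjc /augment map_col_mx -/(mxconjc _) -/(mxconjc (mxconjc A)) mxconjcK.
by rewrite mul_block_col !mul0mx !mul1mx addr0 add0r.
Qed.

Lemma augmentD {m n : nat} (A B : 'M[R[i]]_(m, n)) :
  augment (A + B) = augment A + augment B.
Proof. by rewrite /augment /mxconjc map_mxD add_col_mx. Qed.

Lemma augment_mul_real {m n p : nat} (A : 'M[R[i]]_(m, n)) (B : 'M[R]_(n, p)) :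
  augment (A *m mxreal B) = augment A *m mxreal B.
Proof.
rewrite /augment mul_col_mx mxconjc_mul; congr (col_mx _ (_ *m _)).
by apply/matrixP => i j; rewrite !mxE /= oppr0.
Qed.

Lemma mul_row_swap {k n : nat} (A B : 'M[R[i]]_(k, n)) :
  row_mx A B *m swapmx = row_mx B A.
Proof. by rewrite mul_row_block !(mulmx0, mulmx1) addr0 add0r. Qed.

(** From a real left inverse of the stacked real and imaginary parts, using
    [Re H = (H + conj H) / 2] and [Im H = i (conj H - H) / 2] to rewrite it in
    terms of the two blocks of [augment H]. *)
Lemma augment_left_inverse {m n : nat} (H : 'M[R[i]]_(m, n)) :
    \rank (col_mx (mxRe H) (mxIm H)) = n ->
  exists L : 'M[R[i]]_(n, m + m), L *m augment H = 1%:M.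
Proof.
move=> rkH; have : row_full (col_mx (mxRe H) (mxIm H)) by rewrite -col_leq_rank rkH.
move=> /row_fullP[B BH].
have BHc : mxreal (lsubmx B) *m mxreal (mxRe H) +
    mxreal (rsubmx B) *m mxreal (mxIm H) = 1%:M.
  rewrite -!map_mxM -map_mxD -mul_row_col hsubmxK BH; exact: map_mx1.
have ReE : mxreal (mxRe H) = 2^-1 *: (H + mxconjc H).
  by apply/matrixP => i j; rewrite !mxE ReJ_add mulrC.
have ImE : mxreal (mxIm H) = (2^-1 * 'i%C) *: (mxconjc H - H).
  by apply/matrixP => i j; rewrite !mxE ImJ_sub; ring.
exists (row_mx (2^-1 *: mxreal (lsubmx B) - (2^-1 * 'i%C) *: mxreal (rsubmx B))
               (2^-1 *: mxreal (lsubmx B) + (2^-1 * 'i%C) *: mxreal (rsubmx B))).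
rewrite mul_row_col -BHc ReE ImE.
move: (mxreal (lsubmx B)) (mxreal (rsubmx B)) (2^-1 * 'i%C) => X Y c.
rewrite mulmxBl mulmxDl -!scalemxAl -!scalemxAr mulmxDr mulmxBr.
rewrite scalerDr scalerBr [_ - _ + (_ + _)]addrACA; congr (_ + _).
by rewrite addrC.
Qed.

End Augmentation.

(** * Widely linear estimators *)

Section WidelyLinear.
Context {d : measure_display} {T : measurableType d} {R : realType}.
Variables (P : probability T R) (Ny Nx : nat).
Variables (H : 'M[R[i]]_(Ny, Nx)) (n : T -> 'cV[R[i]]_Ny).

Definition wl_row (e f : 'cV[R[i]]_Ny) : 'rV[R[i]]_(Ny + Ny) :=
  row_mx (mxadjc e) (mxadjc f).

Lemma wl_componentE e f y :
  wl_component e f y = (wl_row e f *m augment y) 0 0.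
Proof. by rewrite /wl_component mul_row_col. Qed.

(** Evaluating at the multiples of the basis vectors by [1] and by [i] shows
    that the two halves of the row are conjugate. *)
Lemma wl_real_valuedP e f :
  wl_real_valued e f <-> mxconjc (wl_row e f) = wl_row e f *m swapmx.
Proof.
split=> [ef_real|ef_conj y].
  rewrite mul_row_swap /wl_row /mxconjc map_row_mx -!/(mxconjc _).
  suff ef : mxconjc (mxadjc e) = mxadjc f by rewrite -ef mxconjcK.
  apply/rowP => j; rewrite mxE.
  set a := mxadjc e 0 j; set b := mxadjc f 0 j.
  have ab (c : R[i]) : complex.Im (a * c + b * conjc c) = 0.
    have := ef_real (c *: delta_mx j 0); rewrite /wl_component.
    have -> : mxconjc (c *: delta_mx j 0 : 'cV_Ny) = conjc c *: delta_mx j 0.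
      by rewrite /mxconjc map_mxZ map_delta_mx.
    have entry (u : 'rV[R[i]]_Ny) (x : R[i]) :
        (u *m (x *: delta_mx j 0 : 'cV_Ny)) 0 0 = u 0 j * x.
      by rewrite -scalemxAr -colE mxE mxE mulrC.
    by rewrite mxE !entry.
  move: (ab 1) (ab 'i%C) => {ab}; move: a b => [a1 a2] [b1 b2] /=.
  rewrite !(mulr0, mulr1, mul0r, oppr0, addr0, add0r, mulrN) => /eqP + /eqP.
  rewrite subr_eq0 addr_eq0 => /eqP -> /eqP ->.
  by rewrite opprK.
rewrite wl_componentE.
have conjM : mxconjc (wl_row e f *m augment y) = wl_row e f *m augment y.
  rewrite mxconjc_mul ef_conj mxconjc_augment -mulmxA [swapmx *m _]mulmxA.
  by rewrite swapmxK mul1mx.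
have /(congr1 (@complex.Im R)) : conjc ((wl_row e f *m augment y) 0 0) =
    (wl_row e f *m augment y) 0 0 by rewrite -[in RHS]conjM [RHS]mxE.
by rewrite ImJ => /eqP; rewrite eq_sym -addr_eq0 -mulr2n mulrn_eq0 => /eqP.
Qed.

Hypotheses (n_L2 : square_integrable P n) (n_mean0 : mxexpect P n = 0).
Hypothesis C_unit : augcov P n \in unitmx.

Let C := augcov P n.

Lemma augment_L2 : mxLfunc P 2%:E (fun w => augment (n w)).
Proof.
move=> i j; rewrite ord1; case: (split_ordP i) => k ->.
  by under eq_fun do rewrite col_mxEu; exact: n_L2.
under eq_fun do rewrite col_mxEd mxE.
by apply: Lfunc_conj; [rewrite lee1n|exact: n_L2].
Qed.

Lemma n_integrable : mxLfunc P 1 n.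
Proof. by move=> i j; rewrite ord1; apply: Lfunc21; exact: n_L2. Qed.

Lemma augment_mean0 : mxexpect P (fun w => augment (n w)) = 0.
Proof.
have -> : 0 = augment (mxexpect P n) :> 'cV[R[i]]_(Ny + Ny).
  by rewrite n_mean0 /augment /mxconjc map_mx0 col_mx0.
rewrite /augment -mxexpect_conj; last exact: n_integrable.
apply/matrixP => i j; rewrite mxE; case: (split_ordP i) => k ->.
  by rewrite col_mxEu mxE; under eq_fun do rewrite col_mxEu.
by rewrite col_mxEd mxE; under eq_fun do rewrite col_mxEd.
Qed.

Lemma augcov_psd : psdmx C.
Proof. exact: second_moment_psd augment_L2. Qed.

(** The form taken by the block structure of the augmented covariance matrix:
    its diagonal blocks, and its off-diagonal blocks, are conjugate. *)
Lemma mxconjc_augcov : mxconjc C = swapmx *m C *m swapmx.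
Proof.
rewrite /C /augcov -mxexpect_conj; last exact: mxLfunc_outer augment_L2.
rewrite -{2}swapmx_herm -(second_moment_linear augment_L2).
by under eq_fun do rewrite mxconjc_mul -mxadjc_conj mxconjc_augment.
Qed.

Lemma augment_observation x w :
  augment (observation H n x w) = augment H *m mxreal x + augment (n w).
Proof. by rewrite augmentD augment_mul_real. Qed.

Lemma gain_observation {k : nat} (K : 'M[R[i]]_(k, Ny + Ny)) x :
  (fun w => K *m augment (observation H n x w)) =
  (fun w => K *m augment H *m mxreal x + K *m augment (n w)).
Proof. by apply/funext => w; rewrite augment_observation mulmxDr mulmxA. Qed.

Lemma wl_component_observation e f x :
  (fun w => wl_component e f (observation H n x w)) =
  (fun w => (wl_row e f *m augment H *m mxreal x +
             wl_row e f *m augment (n w)) 0 0).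
Proof.
apply/funext => w.
by rewrite wl_componentE augment_observation mulmxDr mulmxA.
Qed.

(** The real basis vectors already determine the complex row, although the
    parameter ranges over real vectors only. *)
Lemma wl_unbiasedP i e f :
  wl_unbiased P H n i e f <-> wl_row e f *m augment H = delta_mx 0 i.
Proof.
have mean x : cexpect P (fun w => wl_component e f (observation H n x w)) =
    (wl_row e f *m augment H *m mxreal x) 0 0.
  by rewrite wl_component_observation (cexpect_affine augment_L2 augment_mean0).
split=> [ef_unb|efH x]; last by rewrite mean efH -rowE !mxE.
apply/rowP => j; have := ef_unb (delta_mx j 0); rewrite mean.
rewrite /mxreal map_delta_mx -colE !mxE => ->.
by rewrite eqxx andbT /=; case: eqVneq; rewrite ?eqxx.
Qed.

Lemma wl_varianceE e f x : wl_variance P H n e f x =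
  (complex.Re ((wl_row e f *m C *m mxadjc (wl_row e f)) 0 0))%:E.
Proof.
rewrite /wl_variance wl_component_observation.
exact: (cvariance_affine augment_L2 augment_mean0).
Qed.

Lemma wl_admissibleP i e f : wl_admissible P H n i e f <->
  mxconjc (wl_row e f) = wl_row e f *m swapmx /\
  wl_row e f *m augment H = delta_mx 0 i.
Proof.
split=> -[ef1 ef2].
  by split; [exact/wl_real_valuedP | exact/wl_unbiasedP].
by split; [exact/wl_real_valuedP | exact/wl_unbiasedP].
Qed.

Hypothesis H_full : \rank (col_mx (mxRe H) (mxIm H)) = Nx.

Let G := BW_gain H C.

Lemma BW_gram_unit : BW_gram H C \in unitmx.
Proof.
have [L LH] := augment_left_inverse H_full.
exact: gram_unit LH augcov_psd C_unit.
Qed.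

Lemma BW_gainK : G *m augment H = 1%:M.
Proof.
have [L LH] := augment_left_inverse H_full.
exact: gain_unbiased LH augcov_psd C_unit.
Qed.

Lemma BW_gain_variance : G *m C *m mxadjc G = invmx (BW_gram H C).
Proof.
have [L LH] := augment_left_inverse H_full.
exact: gain_variance LH augcov_psd C_unit.
Qed.

(** The symmetries of [C] and [augment H] cancel in the Gram matrix, which is
    therefore real, and leave a single swap on the right of the gain. *)
Lemma mxconjc_BW_gain : mxconjc G = G *m swapmx.
Proof.
have Cinv : mxconjc (invmx C) = swapmx *m invmx C *m swapmx.
  rewrite mxconjc_inv mxconjc_augcov; apply: mulmx1_invmx.
  rewrite -!mulmxA (mulmxA swapmx swapmx) swapmxK mul1mx (mulmxA (invmx C)).
  by rewrite mulVmx// mul1mx swapmxK.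
have Hadj : mxconjc (mxadjc (augment H)) = mxadjc (augment H) *m swapmx.
  by rewrite -mxadjc_conj mxconjc_augment mxadjcM swapmx_herm.
have half : mxconjc (mxadjc (augment H) *m invmx C) =
    mxadjc (augment H) *m invmx C *m swapmx.
  rewrite mxconjc_mul Hadj Cinv -!mulmxA (mulmxA swapmx swapmx) swapmxK mul1mx.
  by [].
have gram_real : mxconjc (BW_gram H C) = BW_gram H C.
  rewrite /BW_gram mxconjc_mul half mxconjc_augment -!mulmxA.
  by rewrite (mulmxA swapmx swapmx) swapmxK mul1mx.
rewrite /G /BW_gain -mulmxA mxconjc_mul half mxconjc_inv gram_real.
by rewrite !mulmxA.
Qed.

Lemma BW_row_admissible i (g := row i G) :
  mxconjc g = g *m swapmx /\ g *m augment H = delta_mx 0 i.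
Proof.
rewrite /g; split.
  by rewrite -row_mul -mxconjc_BW_gain; apply/rowP => j; rewrite !mxE.
by rewrite -row_mul BW_gainK rowE mulmx1.
Qed.

Lemma wl_row_adj (g1 g2 : 'rV[R[i]]_Ny) :
  wl_row (mxadjc g1) (mxadjc g2) = row_mx g1 g2.
Proof. by rewrite /wl_row !mxadjcK. Qed.

(** The Gauss-Markov identity read on real parts, the only ones that the
    variance sees. *)
Lemma variance_excess i (g : 'rV[R[i]]_(Ny + Ny)) (h := g - row i G) :
  g *m augment H = delta_mx 0 i ->
  complex.Re ((g *m C *m mxadjc g) 0 0) =
  complex.Re ((row i G *m C *m mxadjc (row i G)) 0 0) +
  complex.Re ((h *m C *m mxadjc h) 0 0).
Proof.
move=> gH; have [L LH] := augment_left_inverse H_full.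
have := gauss_markov LH augcov_psd C_unit gH (rowE i G).
move=> /(congr1 (fun M : 'M[R[i]]_1 => complex.Re (M 0 0))) ->.
by rewrite [X in complex.Re X]mxE raddfD.
Qed.

(** The row of the gain is itself admissible, so an optimal row has
    nonpositive excess over it; definiteness then makes the two rows equal. *)
Lemma wl_optimalP i e f : wl_optimal P H n i e f <-> wl_row e f = row i G.
Proof.
split=> [[/wl_admissibleP[_ efH] ef_min]|ef].
  have [G_conj GH] := BW_row_admissible i.
  have G_row : wl_row (mxadjc (lsubmx (row i G))) (mxadjc (rsubmx (row i G))) = row i G.
    by rewrite wl_row_adj hsubmxK.
  have := ef_min (mxadjc (lsubmx (row i G))) (mxadjc (rsubmx (row i G))).
  rewrite wl_admissibleP G_row => /(_ (conj G_conj GH) 0).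
  rewrite !wl_varianceE G_row lee_fin (variance_excess efH) gerDl => h_le0.
  have [_ C_ge0] := augcov_psd.
  apply/eqP; rewrite -subr_eq0; apply/eqP.
  apply: (psdmx_definite augcov_psd C_unit).
  move: (C_ge0 (wl_row e f - row i G)) h_le0; rewrite lecE.
  case: (_ 0 0) => a b /= /andP[/eqP -> a_ge0] a_le0.
  by congr (_ +i* _); apply/le_anti; rewrite a_le0 a_ge0.
have adm : wl_admissible P H n i e f.
  by apply/wl_admissibleP; rewrite ef; exact: BW_row_admissible.
split=> // e' f' /wl_admissibleP[_ efH'] x.
rewrite !wl_varianceE ef lee_fin (variance_excess efH') lerDl.
have [_ C_ge0] := augcov_psd.
by move: (C_ge0 (wl_row e' f' - row i G)); rewrite lecE => /andP[].
Qed.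

Lemma is_BWLUEP (xhat : 'cV[R[i]]_Ny -> 'cV[R[i]]_Nx) :
  is_BWLUE P H n xhat <-> (forall y, xhat y = G *m augment y).
Proof.
split=> [[E [F [xhatE EF_opt]]] y|xhatE].
  rewrite xhatE -mul_row_col; congr (_ *m _); apply/row_matrixP => i.
  by have /wl_optimalP := EF_opt i; rewrite wl_row_adj row_row_mx.
exists (lsubmx G), (rsubmx G); split=> [y|i].
  by rewrite xhatE -mul_row_col hsubmxK.
by apply/wl_optimalP; rewrite wl_row_adj -row_row_mx hsubmxK.
Qed.

Lemma BW_unbiased x :
  mxexpect P (fun w => G *m augment (observation H n x w)) = mxreal x.
Proof.
by rewrite gain_observation (mean_affine augment_L2 augment_mean0) BW_gainK mul1mx.
Qed.

Lemma BW_covariance x :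
  mxcovariance P (fun w => G *m augment (observation H n x w)) =
  G *m C *m mxadjc G.
Proof.
by rewrite gain_observation (mxcovariance_affine augment_L2 augment_mean0).
Qed.

End WidelyLinear.

Theorem mainTheorem1 (d : measure_display) (T : measurableType d)
  (R : realType) (P : probability T R) (Nx Ny : nat)
  (H : 'M[R[i]]_(Ny, Nx)) (n : T -> 'cV[R[i]]_Ny)
  (n_L2 : square_integrable P n)
  (n_mean0 : mxexpect P n = 0)
  (C_unit : augcov P n \in unitmx)
  (le_Nx_2Ny : (Nx <= 2 * Ny)%N)
  (H_full_rank : \rank (col_mx (mxRe H) (mxIm H)) = minn (Ny + Ny) Nx) :
  let C := augcov P n in
  let G := BW_gain H C in
  let xBW (y : 'cV[R[i]]_Ny) : 'cV[R[i]]_Nx := G *m augment y in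
  [/\ BW_gram H C \in unitmx,
      forall xhat : 'cV[R[i]]_Ny -> 'cV[R[i]]_Nx,
        is_BWLUE P H n xhat <-> (forall y, xhat y = xBW y),
      forall x : 'cV[R]_Nx,
        mxexpect P (fun w => xBW (observation H n x w)) = mxreal x,
      forall x : 'cV[R]_Nx,
        mxcovariance P (fun w => xBW (observation H n x w))
        = G *m C *m mxadjc G &
      G *m C *m mxadjc G = invmx (BW_gram H C)].
Proof.
have H_full : \rank (col_mx (mxRe H) (mxIm H)) = Nx.
  by rewrite H_full_rank; apply/minn_idPr; rewrite addnn -mul2n.
split.
- exact: BW_gram_unit.
- by move=> xhat; exact: is_BWLUEP.
- by move=> x; exact: BW_unbiased.
- by move=> x; exact: BW_covariance.
- exact: BW_gain_variance.
Qed.
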